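(* There exist absolute constants $c>0$ and $n_0$ such that for all integers $n\ge n_0$: (1) $$|E_1(n)|-\max_{\substack{A\in C_1(n)\\ A\not\subseteq E_1(n)}}|A|\ \ge\ c\,\frac{n}{(\log\log n)^{2}};$$ (2) $$|E_2(n)|-\max_{\substack{A\in C_2(n)\\ A\not\subseteq E_2(n)}}|A|\ \ge\ c\,\frac{n}{(\log\log n)^{5}}.$$
   Context: Let $\mathbb{Z}^{+}$ be the set of positive integers and $p_i$ the $i$th prime. For positive integers $k,n$: $C_k(n)$ is the family of all subsets $A\subseteq\{1,2,\ldots,n\}$ that do not contain $k+1$ (distinct) pairwise coprime integers; $E_k(n)$ is the set of positive integers not exceeding $n$ that are divisible by at least one of $p_1,\ldots,p_k$; $|A|$ denotes the number of elements of $A$. *)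

(* Defs.v *)
From mathcomp Require Import all_boot.

Set Implicit Arguments.
Unset Strict Implicit.
Unset Printing Implicit Defensive.

Lemma next_prime_subproof (m : nat) : exists p, (m < p) && prime p.
Proof. by have [p lt_mp pr_p] := prime_above m; exists p; rewrite lt_mp. Qed.

Definition next_prime (m : nat) : nat := ex_minn (next_prime_subproof m).

(* Indexed from 1: p_1 = 2, p_2 = 3; the value 0 at index 0 is junk. *)
Definition nth_prime (i : nat) : nat := iter i next_prime 0.

(* The integers 1, ..., n are the nonzero elements of 'I_n.+1. *)
Definition interval1 (n : nat) : {set 'I_n.+1} := [set x : 'I_n.+1 | 0 < x].

Definition pairwise_coprime (n : nat) (B : {set 'I_n.+1}) : bool :=
  [forall x in B, forall y in B, (x != y) ==> coprime x y].

Definition C (k n : nat) : {set {set 'I_n.+1}} :=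
  [set A : {set 'I_n.+1} | (A \subset interval1 n) &&
    ~~ [exists B : {set 'I_n.+1},
          [&& B \subset A, #|B| == k.+1 & pairwise_coprime B]]].

Definition E (k n : nat) : {set 'I_n.+1} :=
  [set x in interval1 n | has (fun i => nth_prime i %| x) (iota 1 k)].

(* For n >= 1 the maximum is over a nonempty family (see [C_notin_E]), so the
   default value 0 of \max on an empty range plays no role. *)
Definition maxC_notin_E (k n : nat) : nat :=
  \max_(A in C k n | ~~ (A \subset E k n)) #|A|.

Lemma nth_prime1 : nth_prime 1 = 2.
Proof.
rewrite /nth_prime /= /next_prime; case: ex_minnP => p /andP[_ pr_p] min_p.
by apply/eqP; rewrite eqn_leq prime_gt1 // min_p.
Qed.

Lemma nth_prime2 : nth_prime 2 = 3.
Proof.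
rewrite -[nth_prime 2]/(next_prime (nth_prime 1)) nth_prime1 /next_prime.
case: ex_minnP => p /andP[lt2p _] min_p.
by apply/eqP; rewrite eqn_leq lt2p min_p.
Qed.

Lemma prime_nth_prime (i : nat) : prime (nth_prime i.+1).
Proof.
by rewrite /nth_prime iterS /next_prime; case: ex_minnP => p /andP[].
Qed.

Lemma C_notin_E (k n : nat) : 0 < k -> 0 < n ->
  exists A : {set 'I_n.+1}, (A \in C k n) && ~~ (A \subset E k n).
Proof.
move=> k0 n0; have v1 : (inord 1 : 'I_n.+1) = 1 :> nat by rewrite inordK.
exists [set inord 1]; rewrite inE !sub1set !inE v1 /=; apply/andP; split.
  apply/existsP => -[B /and3P[/subset_leq_card sB /eqP cB _]].
  by move: sB; rewrite cB cards1 ltnS leqNgt k0.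
apply/hasPn => -[|i]; first by rewrite mem_iota.
by move=> _; rewrite dvdn1 neq_ltn prime_gt1 ?orbT ?prime_nth_prime.
Qed.

(* Main.v *)
Require Import Defs.
From mathcomp Require Import all_boot all_order all_algebra.
From mathcomp Require Import all_classical all_reals all_analysis.
From mathcomp Require Import zify ring lra.

(** If A in C 1 n contains an odd m, then each pair {2j+1, 2j+2} meets A at
    most once, and not at all when both members are coprime to m (j > 0).  If A
    in C 2 n contains an m coprime to 6, then each window {6j+1, ..., 6j+6}
    contains at most 4 elements of A, and at most 3 when 6j+1, 6j+3, 6j+4 and
    6j+5 are coprime to m (j > 0), since A then contains at most one of these
    four.  So the gap is at least the number of such j, up to O(1).
    Legendre's sieve over the primes p dividing m, removing w_p <= k classes
    modulo p, counts them: the error is at most (k+1)^omega(m) = O(sqrt n), and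
    the density prod (1 - w_p/p) is at least c (loglog n)^-k, because sum 1/p
    over p | m is at most logloglog n + O(1): the primes up to log_2 n are
    handled by Mertens' upper bound, and there are at most log_2 n others. *)

Set Implicit Arguments.
Unset Strict Implicit.
Unset Printing Implicit Defensive.

Import Order.TTheory GRing.Theory Num.Theory.

(** * Products of primes *)

Lemma prod_primes_dvd (s : seq nat) (N : nat) :
  uniq s -> all prime s -> {in s, forall p, p %| N} -> \prod_(p <- s) p %| N.
Proof.
elim: s => [|p s IHs] /=; first by rewrite big_nil dvd1n.
move=> /andP[ps us] /andP[pp aps] dvs; rewrite big_cons Gauss_dvd.
  rewrite dvs ?mem_head // IHs // => q qs.
  by rewrite dvs // inE qs orbT.
rewrite prime_coprime // Euclid_dvd_prod // big_has.
apply: contraNN ps => /hasP[q qs]; rewrite dvdn_prime2 ?(allP aps q) //.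
by move=> /eqP ->.
Qed.

Lemma prime_dvd_fact (p k : nat) : prime p -> p %| k`! -> p <= k.
Proof.
move=> pp; elim: k => [|k IHk]; first by rewrite fact0 Euclid_dvd1.
by rewrite factS Euclid_dvdM // => /orP[/dvdn_leq->//|/IHk /leqW].
Qed.

(** The equal coefficients at k and k+1 both occur in the expansion of (1+1)^(2k+1), so each is at
    most half of it. *)
Lemma bin_double_le (k : nat) : 'C(k.*2.+1, k) <= 4 ^ k.
Proof.
have -> : 4 ^ k = 2 ^ k.*2 by rewrite -mul2n expnM.
rewrite -(leq_pmul2l (isT : 0 < 2)) -expnS mul2n -addnn.
have -> : 2 ^ k.*2.+1 = \sum_(i < k.*2.+2) 'C(k.*2.+1, i).
  rewrite -[2]/(1 + 1) Pascal.
  by apply: eq_bigr => i _; rewrite !exp1n !muln1.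
have H : k < k.*2.+2 by lia.
rewrite (bigD1 (Ordinal H)) //=.
have H1 : k.+1 < k.*2.+2 by lia.
rewrite (bigD1 (Ordinal H1)) /=; last by rewrite -val_eqE /=; lia.
rewrite addnA.
suff -> : 'C(k.*2.+1, k.+1) = 'C(k.*2.+1, k) by rewrite leq_addr.
by rewrite -bin_sub ; [congr ('C(_, _)); lia | lia].
Qed.

(** Erdős's induction. An even n > 2 adds no prime. For n = 2k+1 the primes in (k+1, 2k+1] all
    divide ['C(2k+1, k)], and those up to k+1 fall under the induction hypothesis. *)
Lemma primorial_le (n : nat) : \prod_(0 <= p < n.+1 | prime p) p <= 4 ^ n.
Proof.
elim/ltn_ind: n => n IHn.
have [n2|n2] := leqP n 2.
  by case: n n2 {IHn} => [|[|[|]]] // _; rewrite !big_mkcond /= unlock.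
case: (boolP (odd n)) => on; last first.
  case: n on n2 IHn => // n on n2 IHn.
  rewrite big_mkcond big_nat_recr //= -big_mkcond ifF ?muln1.
    by rewrite (leq_trans (IHn n _)) // leq_exp2l.
  apply/negP => /even_prime[|/= on']; first by lia.
  by move: on; rewrite /= on'.
set k := n./2.
have nE : n = k.*2.+1 by rewrite -[LHS]odd_double_half on.
have k0 : 0 < k by lia.
rewrite (@big_cat_nat _ _ _ k.+2) //=; last by lia.
have -> : 4 ^ n = 4 ^ k.+1 * 4 ^ k by rewrite -expnD; congr (_ ^ _); lia.
rewrite leq_mul //; first by rewrite IHn //; lia.
apply: leq_trans (bin_double_le k).
apply: dvdn_leq; first by rewrite bin_gt0; lia.
rewrite -big_filter; apply: prod_primes_dvd.
- by rewrite filter_uniq // iota_uniq.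
- by apply/allP => p; rewrite mem_filter => /andP[].
move=> p; rewrite mem_filter mem_index_iota => /and3P[pp lep ltp].
have: p %| 'C(k.*2.+1, k) * (k`! * (k.*2.+1 - k)`!).
  by rewrite bin_fact ?dvdn_fact //; lia.
rewrite Euclid_dvdM // => /orP[//|].
by rewrite Euclid_dvdM // => /orP[] /(prime_dvd_fact pp); lia.
Qed.

(** The exponent n %/ p counts the multiples of p up to n. After exchanging the products, each i <=
    n contributes the product of its distinct prime divisors, which divides i. *)
Lemma prod_prime_expn_le (n : nat) :
  \prod_(0 <= p < n.+1 | prime p) p ^ (n %/ p) <= n ^ n.
Proof.
have -> : n ^ n = \prod_(1 <= i < n.+1) n.
  by rewrite prod_nat_const_nat subSS subn0.
under eq_bigr => p _ do rewrite divn_count_dvd expn_sum.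
rewrite exchange_big_nat /=.
rewrite !big_nat; apply: leq_prod => i /andP[i0 lein].
apply: (@leq_trans i) => //.
rewrite (eq_bigr (fun p => if p %| i then p else 1)); last by move=> p _; case: (p %| i).
rewrite -big_mkcondr -big_filter dvdn_leq //; apply: prod_primes_dvd.
- by rewrite filter_uniq // iota_uniq.
- by apply/allP => p; rewrite mem_filter => /andP[/andP[]].
by move=> p; rewrite mem_filter => /andP[/andP[]].
Qed.

Lemma prod_primes_le (m : nat) : 0 < m -> \prod_(p <- primes m) p <= m.
Proof.
move=> m0; apply: dvdn_leq => //; apply: prod_primes_dvd.
- exact: primes_uniq.
- by apply/allP => p; rewrite mem_primes => /andP[].
by move=> p; rewrite mem_primes => /and3P[].
Qed.

(** A prime p >= b pays for its own factor b, and at most b primes lie below b. With b = (k+1)^2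
    this bounds (k+1)^omega(m) by O(sqrt m). *)
Lemma expn_size_primes_le (b m : nat) : 0 < m -> 0 < b ->
  b ^ size (primes m) <= b ^ b * m.
Proof.
move=> m0 b0.
have -> : b ^ size (primes m) = \prod_(p <- primes m) b.
  by rewrite big_const_seq count_predT iter_muln_1.
apply: (@leq_trans (\prod_(p <- primes m) ((if p < b then b else 1) * p))).
  rewrite !big_seq; apply: leq_prod => p; rewrite mem_primes => /andP[pp _].
  by case: ltnP => [_|bp]; rewrite ?mul1n // leq_pmulr ?prime_gt0.
rewrite big_split leq_mul ?prod_primes_le //=.
rewrite -big_mkcond /= big_const_seq iter_muln_1 leq_pexp2l //.
rewrite -size_filter -[leqRHS](size_iota 0) uniq_leq_size //.
  by rewrite filter_uniq ?primes_uniq.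
by move=> p; rewrite mem_filter mem_iota => /andP[].
Qed.

(** * Windows *)

(** Membership tested at a natural number, so that window entries such as 6j+5 need no proof of
    being at most n; above n it is false. *)
Definition nat_mem (n : nat) (A : {set 'I_n.+1}) (x : nat) : bool :=
  [exists y in A, val y == x].

Lemma nat_mem_val (n : nat) (A : {set 'I_n.+1}) (y : 'I_n.+1) :
  nat_mem A y = (y \in A).
Proof.
apply/existsP/idP => [[z /andP[zA /eqP/val_inj <-]] //|yA].
by exists y; rewrite yA eqxx.
Qed.

Lemma card_nat_mem (n : nat) (A : {set 'I_n.+1}) :
  #|A| = \sum_(x < n.+1) nat_mem A x.
Proof.
by rewrite -sum1_card big_mkcond; apply: eq_bigr => y _; rewrite nat_mem_val; case: ifP.
Qed.

Lemma C_not_pairwise_coprime (k n : nat) (A : {set 'I_n.+1}) (s : seq nat) :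
  A \in C k n -> uniq s -> size s = k.+1 -> all (nat_mem A) s -> ~~ pairwise coprime s.
Proof.
rewrite inE => /andP[_ noB] us sz sA; apply: contra noB => pw.
have sn x : x \in s -> x < n.+1.
  by move=> /(allP sA)/existsP[y /andP[_ /eqP <-]]; apply: ltn_ord.
apply/existsP; exists [set y : 'I_n.+1 | val y \in s]; apply/and3P; split.
- by apply/fintype.subsetP => y; rewrite inE => /(allP sA); rewrite nat_mem_val.
- rewrite cardE -sz -(size_map val); apply/eqP/perm_size/uniq_perm => //.
    by rewrite map_inj_uniq ?enum_uniq //; apply: val_inj.
  move=> x; apply/mapP/idP => [[y]|xs]; first by rewrite mem_enum inE => ys ->.
  by exists (Ordinal (sn x xs)); rewrite ?mem_enum ?inE.
apply/'forall_implyP => x; rewrite inE => xs; apply/'forall_implyP => y; rewrite inE => ys.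
apply/implyP => xy.
have /pairwiseP := pw; move=> /(_ 0) H.
have : index (val x) s != index (val y) s.
  by apply: contra xy => /eqP/(congr1 (nth 0 s)); rewrite !nth_index // => /val_inj ->.
by rewrite neq_ltn => /orP[lt|lt]; [|rewrite coprime_sym]; have := H _ _ _ _ lt;
  rewrite !inE !index_mem !nth_index //; apply.
Qed.

Lemma sum_blocks (F : nat -> nat) (b N : nat) :
  \sum_(x < b * N) F x = \sum_(j < N) \sum_(i < b) F (b * j + i).
Proof.
elim: N => [|N IHN]; first by rewrite muln0 !big_ord0.
by rewrite mulnSr big_split_ord big_ord_recr IHN.
Qed.

Lemma sum_blocks_le (F : nat -> nat) (b n : nat) :
  \sum_(j < n %/ b) \sum_(i < b) F (b * j + i.+1) <= \sum_(x < n.+1) F x.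
Proof.
rewrite big_ord_recl; apply: leq_trans (leq_addl _ _).
rewrite -(big_mkord xpredT (fun x => F x.+1)) (@big_cat_nat _ _ _ (b * (n %/ b))) //=; last first.
  by rewrite mulnC leq_trunc_div.
rewrite big_mkord (sum_blocks (fun x => F x.+1)); apply: leq_trans (leq_addr _ _).
by apply: leq_sum => j _; apply: leq_sum => i _; rewrite addnS.
Qed.

(** The full windows miss only the index 0 and an incomplete last window of at most b-1 indices. *)
Lemma sum_blocks_ge (P : pred nat) (b n : nat) : 0 < b ->
  \sum_(x < n.+1) P x <= \sum_(j < n %/ b) \sum_(i < b) P (b * j + i.+1) + b.
Proof.
move=> b0; rewrite big_ord_recl addnC.
rewrite -(big_mkord xpredT (fun x => nat_of_bool (P x.+1)))
  (@big_cat_nat _ _ _ (b * (n %/ b))) //=; last first.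
  by rewrite mulnC leq_trunc_div.
rewrite big_mkord (sum_blocks (fun x => P x.+1)) -addnA leq_add //.
  by apply: leq_sum => j _; apply: leq_sum => i _; rewrite addnS.
apply: (@leq_trans (\sum_(b * (n %/ b) <= i < n) 1 + 1)).
  by rewrite leq_add ?leq_b1 //; apply: leq_sum => i _; apply: leq_b1.
rewrite sum_nat_const_nat muln1; have := divn_eq n b; have := ltn_pmod n b0; lia.
Qed.

(** In [b.+1], b pays for the indices outside the full windows and 1 for the slack at j = 0. *)
Lemma card_add_sifted_le (n b v : nat) (A : {set 'I_n.+1}) (good : pred nat) :
  0 < b ->
  (forall j, \sum_(i < b) nat_mem A (b * j + i.+1) + good j <= v + (j == 0)) ->
  #|A| + \sum_(j < n %/ b) good j <= v * (n %/ b) + b.+1.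
Proof.
move=> b0 block.
rewrite card_nat_mem; apply: leq_trans (leq_add (sum_blocks_ge (nat_mem A) n b0) (leqnn _)) _.
rewrite addnAC -big_split /= -addn1 [b + 1]addnC addnA leq_add2r.
apply: (@leq_trans (\sum_(j < n %/ b) (v + (val j == 0)))); first exact: leq_sum.
rewrite big_split sum_nat_const card_ord mulnC leq_add2l.
case: (n %/ b) => [|N]; first by rewrite big_ord0.
by rewrite big_ord_recl big1.
Qed.

Lemma notin_E (k n : nat) (A : {set 'I_n.+1}) : A \in C k n -> ~~ (A \subset E k n) ->
  exists m, [/\ nat_mem A m, 0 < m <= n & {in iota 1 k, forall i, ~~ (nth_prime i %| m)}].
Proof.
rewrite inE => /andP[/fintype.subsetP A1 _] /fintype.subsetPn[m mA].
rewrite inE A1 //= => /hasPn mE.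
exists m; split => //; first by rewrite nat_mem_val.
by have := A1 m mA; rewrite inE => ->; rewrite -ltnS ltn_ord.
Qed.

(* The slack [j == 0] is for m = 1, which is coprime to itself. *)
Lemma pair_block_le (n m j : nat) (A : {set 'I_n.+1}) : A \in C 1 n -> nat_mem A m ->
  \sum_(i < 2) nat_mem A (2 * j + i.+1) + all (fun i => coprime m (2 * j + i)) [:: 1; 2]
    <= 1 + (j == 0).
Proof.
move=> AC mA.
have nc x y : x != y -> coprime x y -> nat_mem A x -> nat_mem A y -> False.
  move=> xy cxy xA yA.
  have := @C_not_pairwise_coprime 1 n A [:: x; y] AC.
  by rewrite /= inE xy xA yA cxy => /(_ isT erefl isT).
have nm x : 1 < x -> coprime m x -> ~~ nat_mem A x.
  move=> x1 cmx; apply/negP => xA; have xm : x != m.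
    by apply: contraTneq cmx => <-; rewrite /coprime gcdnn; lia.
  by apply: (nc x m) => //; rewrite coprime_sym.
rewrite !big_ord_recr big_ord0 /= add0n andbT.
have c12 : ~~ (nat_mem A (2 * j + 1) && nat_mem A (2 * j + 2)).
  apply/andP => -[]; apply: nc; first by lia.
  by rewrite addn1 addn2 coprimenS.
case: j => [|j] in c12 *.
  by move: c12; rewrite muln0 !add0n; do 2?case: nat_mem => //=; case: (_ && _).
have [c1 c2] := (nm (2 * j.+1 + 1) ltac:(lia), nm (2 * j.+1 + 2) ltac:(lia)).
move: c12 c1 c2; do 2?case: nat_mem; do 2?case: coprime => //=; move=> // _ h1 h2;
 by [have := h1 isT|have := h2 isT|].
Qed.

(** As d divides 6, the gcd of 6j+i with the difference d depends only on i. *)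
Lemma coprime_window (j i d : nat) : d %| 6 -> coprime i d ->
  coprime (6 * j + i) (6 * j + (i + d)).
Proof.
move=> d6 cid; rewrite addnA /coprime gcdnDl -gcdn_modl.
by rewrite -modnDml (eqP (dvdn_mulr j d6)) add0n gcdn_modl.
Qed.

(** The entries at offsets 1, 2, 3, 5 are pairwise coprime, so A has at most two of them, hence at
    most four in the window with offsets 4 and 6. If those at 1, 3, 4, 5 are coprime to m, any two
    of them form a forbidden triple with m, so at most one is in A besides offsets 2 and 6. *)
Lemma triple_block_le (n m j : nat) (A : {set 'I_n.+1}) : A \in C 2 n -> nat_mem A m ->
  \sum_(i < 6) nat_mem A (6 * j + i.+1)
    + all (fun i => coprime m (6 * j + i)) [:: 1; 3; 4; 5] <= 4 + (j == 0).
Proof.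
move=> AC mA.
have nc x y z : x < y -> x < z -> y != z -> coprime x y -> coprime x z -> coprime y z ->
    ~~ [&& nat_mem A x, nat_mem A y & nat_mem A z].
  move=> xy xz yz cxy cxz cyz; apply/negP => /and3P[xA yA zA].
  have nxy : x != y by rewrite neq_ltn xy.
  have nxz : x != z by rewrite neq_ltn xz.
  have := @C_not_pairwise_coprime 2 n A [:: x; y; z] AC.
  by rewrite /= !inE negb_or nxy nxz yz xA yA zA cxy cxz cyz => /(_ isT erefl isT).
have c12 : coprime (6 * j + 1) (6 * j + 2) by rewrite (@coprime_window j 1 1).
have c13 : coprime (6 * j + 1) (6 * j + 3) by rewrite (@coprime_window j 1 2).
have c14 : coprime (6 * j + 1) (6 * j + 4) by rewrite (@coprime_window j 1 3).
(* The difference 4 does not divide 6, so [coprime_window] does not apply; oddness of 6j+1 is used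
   instead. *)
have c15 : coprime (6 * j + 1) (6 * j + 5).
  rewrite -[5]/(1 + 2 ^ 2) addnA /coprime gcdnDl -/(coprime _ _) coprimeXr //.
  by rewrite coprime_sym prime_coprime // dvdn_addr // dvdn_mulr.
have c23 : coprime (6 * j + 2) (6 * j + 3) by rewrite (@coprime_window j 2 1).
have c25 : coprime (6 * j + 2) (6 * j + 5) by rewrite (@coprime_window j 2 3).
have c34 : coprime (6 * j + 3) (6 * j + 4) by rewrite (@coprime_window j 3 1).
have c35 : coprime (6 * j + 3) (6 * j + 5) by rewrite (@coprime_window j 3 2).
have c45 : coprime (6 * j + 4) (6 * j + 5) by rewrite (@coprime_window j 4 1).
rewrite !big_ord_recr big_ord0 /= add0n andbT.
have n123 : ~~ [&& nat_mem A (6 * j + 1), nat_mem A (6 * j + 2) & nat_mem A (6 * j + 3)].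
  by apply: nc => //; lia.
have n125 : ~~ [&& nat_mem A (6 * j + 1), nat_mem A (6 * j + 2) & nat_mem A (6 * j + 5)].
  by apply: nc => //; lia.
have n135 : ~~ [&& nat_mem A (6 * j + 1), nat_mem A (6 * j + 3) & nat_mem A (6 * j + 5)].
  by apply: nc => //; lia.
have n235 : ~~ [&& nat_mem A (6 * j + 2), nat_mem A (6 * j + 3) & nat_mem A (6 * j + 5)].
  by apply: nc => //; lia.
have le4 : nat_mem A (6 * j + 1) + nat_mem A (6 * j + 2) + nat_mem A (6 * j + 3)
    + nat_mem A (6 * j + 4) + nat_mem A (6 * j + 5) + nat_mem A (6 * j + 6) <= 4.
  by move: n123 n125 n135 n235; do 6!case: nat_mem.
(* At j = 0 the slack pays for the indicator. For j > 0 all entries exceed 1, so one coprime to m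
   differs from m. *)
case: (boolP (j == 0)) => [_|j0]; first by rewrite leq_add // leq_b1.
case: and4P => [[m1 m3 m4 m5]|_]; last by rewrite !addn0.
have ncm x y : 1 < x -> x < y -> coprime x y -> coprime m x -> coprime m y ->
    ~~ (nat_mem A x && nat_mem A y).
  move=> x1 xy cxy cmx cmy; apply/negP => /andP[xA yA].
  have neqm z : 1 < z -> coprime m z -> m != z.
    by move=> z1; apply: contraTneq => ->; rewrite /coprime gcdnn; move: z1; clear; lia.
  have xm := neqm x x1 cmx; have ym := neqm y (ltn_trans x1 xy) cmy.
  have nxy : x != y by rewrite neq_ltn xy.
  have := @C_not_pairwise_coprime 2 n A [:: m; x; y] AC.
  by rewrite /= !inE xA yA mA cxy cmx cmy negb_or xm ym nxy => /(_ isT erefl isT).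
have n13 : ~~ (nat_mem A (6 * j + 1) && nat_mem A (6 * j + 3)).
  by apply: ncm => //; move: j0; clear; lia.
have n14 : ~~ (nat_mem A (6 * j + 1) && nat_mem A (6 * j + 4)).
  by apply: ncm => //; move: j0; clear; lia.
have n15 : ~~ (nat_mem A (6 * j + 1) && nat_mem A (6 * j + 5)).
  by apply: ncm => //; move: j0; clear; lia.
have n34 : ~~ (nat_mem A (6 * j + 3) && nat_mem A (6 * j + 4)).
  by apply: ncm => //; move: j0; clear; lia.
have n35 : ~~ (nat_mem A (6 * j + 3) && nat_mem A (6 * j + 5)).
  by apply: ncm => //; move: j0; clear; lia.
have n45 : ~~ (nat_mem A (6 * j + 4) && nat_mem A (6 * j + 5)).
  by apply: ncm => //; move: j0; clear; lia.
by move: n13 n14 n15 n34 n35 n45; do 6!case: nat_mem.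
Qed.

Lemma card_E_ge (k n b v : nat) :
  (forall j, v <= \sum_(i < b) has (fun l => nth_prime l %| b * j + i.+1) (iota 1 k)) ->
  v * (n %/ b) <= #|E k n|.
Proof.
move=> block.
have -> : #|E k n| = \sum_(x < n.+1) ((0 < x) && has (fun l => nth_prime l %| x) (iota 1 k)).
  by rewrite -sum1_card big_mkcond; apply: eq_bigr => x _; rewrite !inE; case: ifP.
apply: leq_trans (sum_blocks_le
  (fun x => (0 < x) && has (fun l => nth_prime l %| x) (iota 1 k)) b n).
rewrite mulnC -[X in X * v](card_ord (n %/ b)) -sum_nat_const.
apply: leq_sum => j _; apply: leq_trans (block j) _.
by apply: leq_sum => i _; rewrite addnS.
Qed.

Lemma card_E1_ge (n : nat) : 1 * (n %/ 2) <= #|E 1 n|.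
Proof.
apply: card_E_ge => j; rewrite !big_ord_recr big_ord0 [iota _ _]/= /has nth_prime1.
by rewrite [2 %| _ + 2]dvdn_addr ?dvdn_mulr // leq_addl.
Qed.

Lemma card_E2_ge (n : nat) : 4 * (n %/ 6) <= #|E 2 n|.
Proof.
apply: card_E_ge => j; rewrite !big_ord_recr big_ord0 [iota _ _]/= /has nth_prime1 nth_prime2.
have h2 : 2 %| 6 * j by rewrite dvdn_mulr.
have h3 : 3 %| 6 * j by rewrite dvdn_mulr.
by rewrite !(dvdn_addr _ h2) !(dvdn_addr _ h3).
Qed.

(** * Legendre's sieve *)

(** For a < p this is the number of t with a + p t < T, that is, (T - a) / p rounded up, and 0 when
    T <= a. *)
Definition residue_count (T p a : nat) : nat := (T + (p.-1 - a)) %/ p.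

Lemma sum_by_residue (V : nmodType) (F : nat -> V) (T p : nat) : 0 < p ->
  (\sum_(j < T) F j =
   \sum_(a < p) \sum_(t < residue_count T p a) F (a + p * t)%N)%R.
Proof.
move=> p0; elim: T => [|T IHT].
  rewrite big_ord0 big1 // => a _; rewrite /residue_count divn_small ?big_ord0 //.
  by lia.
rewrite big_ord_recr IHT /=.
have Tp : T %% p < p by rewrite ltn_pmod.
rewrite (bigD1 (Ordinal Tp)) //= [RHS](bigD1 (Ordinal Tp)) //= -addrA [(_ + F T)%R]addrC addrA.
have rcS a : a < p -> residue_count T.+1 p a = (a == T %% p) + residue_count T p a.
  move=> ap; rewrite /residue_count addSn divnS //; congr (nat_of_bool _ + _).
  have -> : (T + (p.-1 - a)).+1 = (T + p) - a by lia.
  rewrite -eqn_mod_dvd; last by lia.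
  by rewrite modnDr (modn_small ap) eq_sym.
congr (_ + _)%R; last first.
  apply: eq_bigr => a; rewrite -val_eqE /= => aT.
  by rewrite rcS // (negbTE aT).
rewrite rcS // eqxx add1n big_ord_recr /=; congr (_ + F _)%R.
rewrite {1}(divn_eq T p) addnC mulnC; congr (_ + p * _).
rewrite /residue_count {2}(divn_eq T p) -addnA divnMDl // [X in _ + X]divn_small ?addn0 //.
lia.
Qed.

(** The count times p differs from T by at most p - 1, hence from y by at most p. *)
Lemma residue_count_approx (R : realFieldType) (T p a : nat) (y : R) : a < p ->
  (`|T%:R - y| <= 1 -> `|(residue_count T p a)%:R - y / p%:R| <= 1)%R.
Proof.
move=> ap.
have p0 : 0 < p by exact: leq_trans ap.
have pR : (0 < p%:R :> R)%R by rewrite ltr0n.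
set r := residue_count T p a.
have h1 : r * p <= T + (p - 1)
  by have := leq_trunc_div (T + (p.-1 - a)) p; rewrite /r /residue_count; lia.
have h2 : T <= r * p + (p - 1).
  have := divn_eq (T + (p.-1 - a)) p; have := ltn_pmod (T + (p.-1 - a)) p0.
  by rewrite /r /residue_count; lia.
have {}h1 : (r%:R * p%:R + 1 <= T%:R + p%:R :> R)%R.
  by rewrite -natrM -[1%R]/(1%:R)%R -!natrD ler_nat; lia.
have {}h2 : (T%:R + 1 <= r%:R * p%:R + p%:R :> R)%R.
  by rewrite -natrM -[1%R]/(1%:R)%R -!natrD ler_nat; lia.
rewrite !ler_norml => /andP[y1 y2].
have yE : (y / p%:R * p%:R = y)%R by rewrite divfK // gt_eqF.
by apply/andP; split; rewrite -(ler_pM2r pR) mulrBl yE; lra.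
Qed.

(** Since p is invertible modulo q, t -> a + p t permutes the residues modulo q. In the sieve,
    restricting to a class modulo one prime thus preserves the number of bad classes modulo
    another. *)
Lemma count_arith_progression (q p a : nat) (P : pred nat) : coprime p q ->
  (forall x, P (x + q) = P x) ->
  count (fun t => P (a + p * t)) (iota 0 q) = count P (iota 0 q).
Proof.
move=> cpq perP.
case: q => // q in cpq perP *.
have perM x : P (x %% q.+1) = P x.
  rewrite [in RHS](divn_eq x q.+1) addnC.
  by elim: (_ %/ _) => [|k IHk]; rewrite ?addn0 // mulSnr addnA perP.
rewrite (eq_count (a2 := preim (fun t => (a + p * t) %% q.+1) P)) => [|t]; last by rewrite /= perM.
have U : uniq [seq (a + p * t) %% q.+1 | t <- iota 0 q.+1].
  rewrite map_inj_in_uniq ?iota_uniq // => x y; rewrite !mem_iota !add0n => /andP[_ xq] /andP[_ yq].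
  move=> /eqP; rewrite eqn_modDl.
  wlog lexy : x y xq yq / x <= y.
    move=> W; case: (leqP x y) => [le|/ltnW le]; first exact: W.
    by rewrite eq_sym => /(W _ _ yq xq le).
  rewrite eq_sym eqn_mod_dvd ?leq_mul2l ?lexy ?orbT // -mulnBr.
  rewrite Gauss_dvdr; last by rewrite coprime_sym.
  case: (posnP (y - x)) => [|yx0 /(dvdn_leq yx0)]; lia.
rewrite -count_map; apply/permP; apply: uniq_perm => //; first exact: iota_uniq.
apply: (uniq_min_size U _ _).2; last by rewrite size_map.
by move=> x /mapP[t _ ->]; rewrite mem_iota ltn_pmod.
Qed.

(* Allowing a slack |T - y| <= 1 makes the induction close: the number of j < T
   in a class modulo p is again within 1 of y / p. *)
Lemma sieve_error (R : realFieldType) (ps : seq nat) (bad : nat -> pred nat)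
    (T : nat) (y : R) :
  uniq ps -> all prime ps ->
  (forall p x, p \in ps -> bad p (x + p) = bad p x) ->
  (`|T%:R - y| <= 1)%R ->
  let w p := count (bad p) (iota 0 p) in
  (`| (\sum_(j < T) all (fun p => ~~ bad p j) ps)%:R
      - y * \prod_(p <- ps) (1 - (w p)%:R / p%:R)|
    <= \prod_(p <- ps) (1 + (w p)%:R))%R.
Proof.
elim: ps bad T y => [|p ps IHps] bad T y /=.
  by move=> _ _ _; rewrite !big_nil mulr1 sum1_card card_ord.
move=> /andP[pps ups] /andP[pp aps] per Ty.
have p0 := prime_gt0 pp.
set w := fun p => count (bad p) (iota 0 p).
rewrite !big_cons -/(w p).
set rest := fun j => all (fun p => ~~ bad p j) ps.
set D := (\prod_(p <- ps) (1 - _))%R; set Er := (\prod_(p <- ps) _)%R.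
have per' q x : q \in ps -> bad q (x + q) = bad q x.
  by move=> qps; apply: per; rewrite inE qps orbT.
have perM x a : bad p (a + p * x) = bad p a.
  elim: x => [|x IHx]; first by rewrite muln0 addn0.
  by rewrite mulnS addnCA addnC per ?mem_head.
have H0 := IHps bad T y ups aps per' Ty.
pose S a := (\sum_(t < residue_count T p a) rest (a + p * t)%N)%N.
(* The induction hypothesis is applied inside the class of a modulo p: y becomes y / p, and each w q
   is unchanged. *)
have Hs a : a < p -> (`| (S a)%:R - (y / p%:R) * D| <= Er)%R.
  move=> ap.
  have := IHps (fun q t => bad q (a + p * t)) (residue_count T p a) (y / p%:R)%R ups aps.
  have wE q : q \in ps -> count (fun t => bad q (a + p * t)) (iota 0 q) = w q.
    move=> qps; apply: count_arith_progression; last by move=> x; exact: per'.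
    rewrite prime_coprime // dvdn_prime2 ?(allP aps q) //.
    by apply: contraNneq pps => ->.
  move=> /(_ _ (residue_count_approx ap Ty)) /=.
  rewrite [X in (_ - _ * X)%R](eq_big_seq (fun p => 1 - (w p)%:R / p%:R)%R);
    last by move=> q /wE ->.
  rewrite [X in (_ <= X)%R](eq_big_seq (fun p => 1 + (w p)%:R)%R); last by move=> q /wE ->.
  apply=> q x qps; rewrite mulnDr addnA.
  by elim: (X in X * q) => [|k IHk]; rewrite ?mul0n ?addn0 // mulSnr addnA per'.
(* Legendre's recursion: the survivors of [ps] are those that also survive p, plus those in a bad
   class modulo p. The w p bad classes cost [Er] each, which gives the new factor 1 + w p. *)
have splitT : (\sum_(j < T) rest j =
    \sum_(j < T) (~~ bad p j && rest j) + \sum_(a < p | bad p a) S a)%N.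
  have -> : (\sum_(a < p | bad p a) S a = \sum_(j < T) (bad p j && rest j))%N.
    rewrite [RHS](@sum_by_residue _ (fun j => nat_of_bool (bad p j && rest j)) T p p0).
    rewrite big_mkcond; apply: eq_bigr => a _; case: ifP => ba.
      by apply: eq_bigr => t _; rewrite perM ba.
    by rewrite big1 // => t _; rewrite perM ba.
  by rewrite -big_split; apply: eq_bigr => j _; case: (bad p j); rewrite //= addn0.
have wpE : (w p = \sum_(a < p | bad p a) 1)%N.
  by rewrite /w -sum1_count -[X in iota _ X]subn0 big_mkord.
have -> : ((\sum_(j < T) (~~ bad p j && rest j))%N%:R =
    (\sum_(j < T) rest j)%N%:R - \sum_(a < p | bad p a) (S a)%:R :> R)%R.
  by rewrite splitT natrD -natr_sum addrK.
have Hsum : (`|\sum_(a < p | bad p a) (S a)%:R - (w p)%:R * (y / p%:R * D)| <= (w p)%:R * Er)%R.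
  rewrite wpE natr_sum !mulr_suml -sumrB.
  apply: le_trans (ler_norm_sum _ _ _) _; apply: ler_sum => a _.
  by rewrite !mul1r Hs.
move: H0 Hsum; rewrite /= -/rest -/D -/Er !ler_norml => /andP[a1 a2] /andP[b1 b2].
have -> : (y * ((1 - (w p)%:R / p%:R) * D) = y * D - (w p)%:R * (y / p%:R * D))%R by ring.
apply/andP; split; lra.
Qed.

Local Open Scope ring_scope.

(** * Mertens' upper bound *)

Lemma ler_sum_sub_uniq (R : numDomainType) (I : eqType) (s r : seq I) (f : I -> R) :
  uniq s -> uniq r -> {subset s <= r} -> {in r, forall i, 0 <= f i} ->
  \sum_(i <- s) f i <= \sum_(i <- r) f i.
Proof.
move=> us ur sr f0.
rewrite [leRHS](bigID (fun i => i \in s)) /= -[X in _ <= X + _]big_filter.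
have -> : \sum_(i <- [seq i <- r | i \in s]) f i = \sum_(i <- s) f i.
  apply: perm_big; apply: uniq_perm; rewrite ?filter_uniq //.
  by move=> i; rewrite mem_filter andb_idr // => /sr.
by rewrite lerDl big_seq_cond sumr_ge0 // => i /andP[/f0].
Qed.

Lemma ln_nat_le (R : realType) (a b : nat) : (0 < a)%N -> (a <= b)%N ->
  ln (a%:R : R) <= ln b%:R.
Proof.
by move=> a0 ab; rewrite ler_ln ?posrE ?ltr0n ?ler_nat // (leq_trans a0).
Qed.

(** Mertens' first theorem, upper half: take logarithms of the two product bounds. The primorial
    supplies one extra factor p, which lifts n %/ p to an upper bound for n / p. *)
Lemma sum_ln_prime_div_le (R : realType) (n : nat) : (0 < n)%N ->
  \sum_(0 <= p < n.+1 | prime p) ln p%:R / p%:R <= ln n%:R + ln 4 :> R.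
Proof.
move=> n0; have nR : 0 < n%:R :> R by rewrite ltr0n.
have prod_le : (\prod_(0 <= p < n.+1 | prime p) p ^ (n %/ p).+1 <= n ^ n * 4 ^ n)%N.
  under eq_bigr do rewrite expnSr.
  by rewrite big_split leq_mul ?primorial_le ?prod_prime_expn_le.
rewrite -(ler_pM2r nR) mulr_suml.
apply: (@le_trans _ _ (\sum_(0 <= p < n.+1 | prime p) ln (p%:R : R) *+ (n %/ p).+1)).
  apply: ler_sum => p pp; have pR : 0 < p%:R :> R by rewrite ltr0n prime_gt0.
  rewrite -[leRHS]mulr_natr -mulrA ler_wpM2l ?ln_ge0 ?ler1n ?prime_gt0 //.
  by rewrite mulrC ler_pdivrMr // -natrM ler_nat ltnW // ltn_ceil ?prime_gt0.
have -> : \sum_(0 <= p < n.+1 | prime p) ln (p%:R : R) *+ (n %/ p).+1 =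
    ln (\prod_(0 <= p < n.+1 | prime p) p ^ (n %/ p).+1)%N%:R.
  apply: expR_inj; rewrite expR_sum lnK; last first.
    by rewrite posrE ltr0n; apply: prodn_cond_gt0 => p pp; rewrite expn_gt0 prime_gt0.
  rewrite rmorph_prod; apply: eq_bigr => p pp.
  have p0 : 0 < p%:R :> R by rewrite ltr0n prime_gt0.
  by rewrite -lnXn // lnK ?posrE ?exprn_gt0 //= natrX.
apply: le_trans (ln_nat_le R _ prod_le) _.
  by apply: prodn_cond_gt0 => p pp; rewrite expn_gt0 prime_gt0.
have n0R : n%:R ^+ n \is @Num.pos R by rewrite posrE exprn_gt0.
have n4R : 4%:R ^+ n \is @Num.pos R by rewrite posrE exprn_gt0 ?ltr0n.
rewrite natrM [X in X * _]natrX [X in _ * X]natrX lnM // !lnXn ?ltr0n //.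
by rewrite -mulrnDl mulr_natr.
Qed.

Lemma sum_inv_prime_le (R : realType) : exists K : R, forall n : nat, (2 <= n)%N ->
  \sum_(0 <= p < n.+1 | prime p) p%:R^-1 <= ln (ln n%:R) + K.
Proof.
pose S n : R := \sum_(0 <= p < n.+1 | prime p) p%:R^-1.
pose A n : R := \sum_(0 <= p < n.+1 | prime p) ln p%:R / p%:R.
have ln_gt0n n : (2 <= n)%N -> 0 < ln n%:R :> R by move=> n2; rewrite ln_gt0 // ltr1n.
(* Chosen so that [abel] is an equality at n = 2. *)
pose K : R := S 2 - A 2 / ln 2 - ln (ln 2) + ln 4 / ln 2.
(* Abel summation, telescoped: the right side grows by at least the left side
   since ln ln (n+1) - ln ln n >= 1 - ln n / ln (n+1). *)
suff abel n : (2 <= n)%N -> S n - A n / ln n%:R <= ln (ln n%:R) - ln 4 / ln n%:R + K.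
  exists (K + 1) => n n2; have := abel n n2; rewrite -/(S n).
  have l0 := ln_gt0n n n2.
  have : A n / ln n%:R <= 1 + ln 4 / ln n%:R.
    rewrite ler_pdivrMr // mulrDl divfK ?gt_eqF // mul1r.
    by rewrite sum_ln_prime_div_le // ltnW.
  lra.
elim: n => // n IHn; rewrite ltnS leq_eqVlt => /orP[/eqP <-|n2].
  rewrite /K; lra.
have {IHn} := IHn n2.
have l0 := ln_gt0n n n2; have l'0 := ln_gt0n n.+1 (ltnW n2).
have ll' : ln n%:R <= ln n.+1%:R :> R by rewrite ln_nat_le // ltnW.
have An : A n <= ln n%:R + ln 4 by rewrite sum_ln_prime_div_le // ltnW.
have -> : S n.+1 = S n + (prime n.+1)%:R / n.+1%:R.
  rewrite /S big_mkcond big_nat_recr //= -big_mkcond /=.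
  by case: (prime _); rewrite ?mul1r ?mul0r.
have -> : A n.+1 = A n + (prime n.+1)%:R / n.+1%:R * ln n.+1%:R.
  rewrite /A big_mkcond big_nat_recr //= -big_mkcond /=.
  by case: (prime _); rewrite ?mul1r ?mul0r // mulrC.
move: l0 l'0 ll' An; set l := ln n%:R; set l' := ln n.+1%:R => l0 l'0 ll' An IHn.
(* The terms of n+1 in S and in A / l' cancel, so the left side grows by A n (1/l - 1/l') only. *)
rewrite mulrDl mulfK ?gt_eqF //.
have lnl : ln l - ln l' <= l / l' - 1.
  have := @le_ln1Dx R (l / l' - 1).
  rewrite addrCA subrr addr0 ln_div ?posrE //; apply.
  have := divr_gt0 l0 l'0; lra.
have : A n * (l^-1 - l'^-1) <= (l + ln 4) * (l^-1 - l'^-1).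
  by rewrite ler_wpM2r // subr_ge0 lef_pV2 ?posrE.
rewrite !mulrBr !mulrDl mulfV ?gt_eqF //.
move: IHn lnl; move: (A n / l) (A n / l') (l / l') (ln 4 / l) (ln 4 / l').
move: (ln l) (ln l') (S n) K (_ / n.+1%:R) => *; lra.
Qed.

(** * Reciprocal sums over the primes dividing one integer *)

Lemma ln2_ge_half (R : realType) : 2^-1 <= ln 2 :> R.
Proof.
have := @le_ln1Dx R (- 2^-1); have -> : 1 - 2^-1 = 2^-1 :> R by lra.
by rewrite lnV ?posrE // lerN2; apply; lra.
Qed.

(** As 16 = 2^4 and ln 2 >= 1/2. The threshold 16 also keeps ln (ln n) positive. *)
Lemma ln_ge2 (R : realType) (n : nat) : (16 <= n)%N -> 2 <= ln n%:R :> R.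
Proof.
move=> n16; apply: le_trans (ln_nat_le R _ n16) => //.
have -> : 16%:R = 2 ^+ 4 :> R by rewrite -natrX.
by rewrite lnXn // -[ln 2 *+ 4]mulr_natl; have := ln2_ge_half R; lra.
Qed.

(** With ln 2 >= 1/2 and ln n >= 2, log_2 n <= 2 ln n <= (ln n)^2. *)
Lemma ln_trunc_log2_le (R : realType) (n : nat) : (16 <= n)%N ->
  ln (trunc_log 2 n)%:R <= 2 * ln (ln n%:R) :> R.
Proof.
move=> n16; have n0 : (0 < n)%N by lia.
have u2 := ln_ge2 R n16.
have L0 : (0 < trunc_log 2 n)%N by rewrite trunc_log_gt0; lia.
have : (trunc_log 2 n)%:R * ln 2 <= ln n%:R :> R.
  rewrite mulr_natl -lnXn // -natrX ln_nat_le ?expn_gt0 //.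
  exact: trunc_logP.
have := ln2_ge_half R; move: u2; set u := ln n%:R => u2 l2 Lu.
have uu : (trunc_log 2 n)%:R <= u ^+ 2.
  have : (trunc_log 2 n)%:R * 2^-1 <= u.
    by apply: le_trans Lu; rewrite ler_wpM2l.
  by nra.
rewrite mulr_natl -lnXn; last by lra.
by rewrite ler_ln ?posrE ?ltr0n // exprn_gt0; lra.
Qed.

Lemma sum_inv_primes_dividing_le (R : realType) : exists K : R,
  forall n m : nat, (16 <= n)%N -> (0 < m <= n)%N ->
  \sum_(p <- primes m) p%:R^-1 <= ln (2 * ln (ln n%:R)) + K.
Proof.
have [K HK] := sum_inv_prime_le R.
exists (K + 1) => n m n16 /andP[m0 mn].
set L := trunc_log 2 n.
have L4 : (4 <= L)%N by apply: trunc_log_max.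
(* Each prime is at least 2, so 2^omega(m) <= m <= n. *)
have szL : (size (primes m) <= L)%N.
  apply: trunc_log_max => //; apply: leq_trans mn; apply: leq_trans (prod_primes_le m0).
  have -> : (2 ^ size (primes m) = \prod_(p <- primes m) 2)%N.
    by rewrite big_const_seq count_predT iter_muln_1.
  rewrite !big_seq; apply: leq_prod => p; rewrite mem_primes => /andP[pp _].
  exact: prime_gt1.
rewrite (bigID (fun p => p <= L)%N) /= addrA lerD //.
  have lnL0 : 0 < ln L%:R :> R by rewrite ln_gt0 // ltr1n; lia.
  apply: (@le_trans _ _ (ln (ln L%:R) + K)); last first.
    have lnL := ln_trunc_log2_le R n16.
    by rewrite lerD2r ler_ln ?posrE //; apply: lt_le_trans lnL.
  apply: le_trans (HK L _); last by lia.
  rewrite -big_filter -[leRHS]big_filter; apply: ler_sum_sub_uniq.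
  - by rewrite filter_uniq ?primes_uniq.
  - by rewrite filter_uniq ?iota_uniq.
  - move=> p; rewrite !mem_filter mem_primes mem_index_iota ltnS => /andP[-> /andP[-> _]].
    by [].
  - by move=> p _; rewrite invr_ge0.
apply: (@le_trans _ _ (\sum_(p <- primes m | ~~ (p <= L)%N) L%:R^-1)).
  apply: ler_sum => p; rewrite -ltnNge => Lp.
  by rewrite lef_pV2 ?posrE ?ltr0n ?ler_nat; lia.
rewrite big_const_seq iter_addr_0 -[leLHS]mulr_natl ler_pdivrMr ?ltr0n; last by lia.
by rewrite mul1r ler_nat (leq_trans _ szL) // count_size.
Qed.

(** Telescoping through 1/p^2 <= 1/(p-1) - 1/p over all integers p >= 2. *)
Lemma sum_inv_sq_primes_le (R : realType) (m : nat) :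
  \sum_(p <- primes m) (p%:R ^+ 2)^-1 <= 1 :> R.
Proof.
apply: (@le_trans _ _ (\sum_(p <- index_iota 2 m.+2) (p%:R ^+ 2)^-1)).
  apply: ler_sum_sub_uniq; rewrite ?primes_uniq ?iota_uniq //.
    move=> p; rewrite mem_primes mem_index_iota => /and3P[pp m0 pm].
    by rewrite prime_gt1 //= ltnS leqW // dvdn_leq.
apply: (@le_trans _ _ (\sum_(2 <= p < m.+2) (- (p.+1.-1%:R)^-1 - (- p.-1%:R^-1)))).
  rewrite !big_nat; apply: ler_sum => -[|[|p]] // _.
  rewrite -!pred_Sn opprK addrC -[p.+2]addn1 natrD.
  have p0 : 0 < p.+1%:R :> R by rewrite ltr0n.
  set x := p.+1%:R in p0 *.
  have -> : x^-1 - (x + 1%:R)^-1 = (x * (x + 1))^-1 by field; apply/andP; split; lra.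
  rewrite lef_pV2 ?posrE; nra.
rewrite (@telescope_sumr _ 2 m.+2 (fun p => - (p.-1%:R)^-1)) //=.
by rewrite opprK invr1 gerDr oppr_le0 invr_ge0.
Qed.

(** The factor is the inverse of 1 + w/(p-w), which is at most exp(w/(p-w)). Here w/(p-w) = w/p +
    w^2/(p(p-w)), and p <= (k+1)(p-w) because p-w >= 1. *)
Lemma sieve_factor_ge (R : realType) (k w p : nat) : (w <= k)%N -> (w < p)%N ->
  expR (- (k%:R / p%:R + (k ^ 2 * k.+1)%:R / p%:R ^+ 2)) <= 1 - w%:R / p%:R :> R.
Proof.
move=> wk wp.
have p0 : 0 < p%:R :> R by rewrite ltr0n; lia.
have d0 : 0 < (p - w)%:R :> R by rewrite ltr0n subn_gt0.
have -> : 1 - w%:R / p%:R = (1 + w%:R / (p - w)%:R)^-1 :> R.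
  have d_neq0 := lt0r_neq0 d0; have p_neq0 := lt0r_neq0 p0.
  rewrite -[X in X - _](divff p_neq0) -[X in (X + _)^-1](divff d_neq0).
  by rewrite -mulrBl -mulrDl -natrB 1?ltnW // -natrD subnK 1?ltnW // invf_div.
rewrite expRN lef_pV2 ?posrE ?expR_gt0 //.
apply: le_trans (expR_ge1Dx _); rewrite lerD2l.
rewrite ler_pdivrMr // -(ler_pM2r (exprn_gt0 2 p0)).
set P := _ / _ ^+ 2.
have -> : (k%:R / p%:R + P) * (p - w)%:R * p%:R ^+ 2 =
    (k * p * (p - w) + k ^ 2 * k.+1 * (p - w))%:R :> R.
  rewrite /P natrD !natrM; field; exact: lt0r_neq0.
rewrite -natrX -natrM ler_nat.
have h1 : (p <= k.+1 * (p - w))%N.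
  have := leq_mul (wk : w < k.+1)%N (leqnn (p - w)).
  have : (w <= w * (p - w))%N by rewrite leq_pmulr ?subn_gt0.
  rewrite mulSn; lia.
have h2 : (k * p * w <= k ^ 2 * k.+1 * (p - w))%N.
  rewrite -[leqLHS]mulnA -[leqRHS]mulnA -mulnn -mulnA leq_mul2l [(p * w)%N]mulnC leq_mul ?orbT //.
have h3 : (w * p ^ 2 <= k * p * p)%N by rewrite -mulnn mulnA !leq_mul.
have h4 : (k * p * (p - w) + k * p * w = k * p * p)%N.
  by rewrite -mulnDr subnK // ltnW.
lia.
Qed.

(** * The sifted count *)

(** Multiplying the factor bounds, k times the sum of 1/p yields (2 ln ln n)^-k up to a constant,
    and the sum of 1/p^2 costs only a constant. *)
Lemma sieve_density_ge (R : realType) (k : nat) : exists2 c : R, 0 < c &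
  forall (n m : nat) (w : nat -> nat), (16 <= n)%N -> (0 < m <= n)%N ->
  {in primes m, forall p, (w p <= k)%N && (w p < p)%N} ->
  c / ln (ln n%:R) ^+ k <= \prod_(p <- primes m) (1 - (w p)%:R / p%:R).
Proof.
have [K HK] := sum_inv_primes_dividing_le R.
pose c1 := k%:R * K + (k ^ 2 * k.+1)%:R.
exists (expR (- c1) / 2 ^+ k) => [|n m w n16 mn wb].
  by rewrite divr_gt0 ?expR_gt0 ?exprn_gt0.
have u2 := ln_ge2 R n16.
have l0 : 0 < ln (ln n%:R) :> R by rewrite ln_gt0; lra.
apply: (@le_trans _ _ (\prod_(p <- primes m)
    expR (- (k%:R / p%:R + (k ^ 2 * k.+1)%:R / p%:R ^+ 2)))); last first.
  rewrite !big_seq; apply: ler_prod => p /wb /andP[w1 w2].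
  by rewrite expR_ge0 sieve_factor_ge.
rewrite -expR_sum sumrN big_split /= -!mulr_sumr.
set s1 := \sum_(i <- _) _; set s2 := \sum_(i <- _) _.
have s1K : s1 <= ln (2 * ln (ln n%:R)) + K := HK n m n16 mn.
have s2K : s2 <= 1 by exact: sum_inv_sq_primes_le.
have -> : expR (- c1) / 2 ^+ k / ln (ln n%:R) ^+ k =
    expR (- (k%:R * (ln (2 * ln (ln n%:R)) + K) + (k ^ 2 * k.+1)%:R * 1)).
  have -> : k%:R * (ln (2 * ln (ln n%:R)) + K) + (k ^ 2 * k.+1)%:R * 1 =
      c1 + ln (2 * ln (ln n%:R)) *+ k.
    by rewrite -[ln _ *+ k]mulr_natl /c1; ring.
  rewrite [- (c1 + _)]opprD expRD -mulrA; congr (_ * _); rewrite expRN -lnXn ?mulr_gt0 //.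
  by rewrite lnK ?posrE ?exprn_gt0 ?mulr_gt0 // exprMn invfM.
by rewrite ler_expR lerN2 lerD // ler_wpM2l.
Qed.

Lemma sieve_remainder_le (R : realType) (k : nat) : exists2 K : R, 0 <= K &
  forall (m n : nat) (w : nat -> nat), (0 < m <= n)%N ->
  {in primes m, forall p, (w p <= k)%N} ->
  \prod_(p <- primes m) (1 + (w p)%:R) <= K * expR (ln n%:R / 2).
Proof.
(* The square of the product is at most b^omega(m) <= b^b m; [expR (ln n / 2)] is sqrt n. *)
pose b := (k.+1 ^ 2)%N.
have b0 : (0 < b)%N by rewrite expn_gt0.
exists (b ^ b)%:R => // m n w /andP[m0 mn] wk.
have n0 : 0 < n%:R :> R by rewrite ltr0n; lia.
set P := \prod_(p <- _) _.
have P0 : 0 <= P by apply: prodr_ge0 => p _; rewrite addr_ge0.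
have Pk : P <= (k.+1 ^ size (primes m))%:R.
  have -> : (k.+1 ^ size (primes m) = \prod_(p <- primes m) k.+1)%N.
    by rewrite big_const_seq count_predT iter_muln_1.
  rewrite rmorph_prod /P !big_seq; apply: ler_prod => p /wk wpk.
  by rewrite addr_ge0 //= -natr1 addrC lerD2r ler_nat.
rewrite -(@ler_pXn2r _ 2) ?nnegrE ?mulr_ge0 ?expR_ge0 //.
have sq : expR (ln n%:R / 2) ^+ 2 = n%:R :> R.
  by rewrite expr2 -expRD -splitr lnK.
rewrite exprMn sq.
apply: (@le_trans _ _ ((k.+1 ^ size (primes m))%:R ^+ 2)).
  by rewrite ler_pXn2r ?nnegrE.
rewrite -natrX -expnM mulnC expnM -natrX -natrM ler_nat.
apply: leq_trans (expn_size_primes_le m0 b0) _.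
by rewrite leq_mul // -mulnn leq_pmulr ?expn_gt0 ?b0.
Qed.

(** With u = ln n, the exponential series gives exp(u/2) >= (u/2)^(k+1)/(k+1)!, and ln u <= u; hence
    u >= [a] suffices. *)
Lemma exp_half_ln_dominates (R : realType) (k : nat) (K : R) :
  exists n0 : nat, forall n : nat, (n0 <= n)%N ->
  K * ln (ln n%:R) ^+ k <= expR (ln n%:R / 2).
Proof.
pose a : R := `|K| * (k.+1)`!%:R * 2 ^+ k.+1.
have a0 : 0 <= a by rewrite !mulr_ge0 ?exprn_ge0.
exists (maxn 16 (Num.bound (expR a))) => n; rewrite geq_max => /andP[n16 nb].
have u2 := ln_ge2 R n16.
have : a <= ln n%:R.
  rewrite -ler_expR lnK ?posrE ?ltr0n; last by lia.
  by apply: le_trans (ltW (archi_boundP (expR_ge0 a))) _; rewrite ler_nat.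
move: u2; set u := ln n%:R => u2 au.
have lu : ln u <= u by have := @le_ln1Dx R (u - 1); rewrite addrCA subrr addr0; lra.
have l0 : 0 <= ln u by rewrite ln_ge0; lra.
apply: (@le_trans _ _ ((u / 2) ^+ k.+1 / (k.+1)`!%:R)); last first.
  have : 0 <= u / 2 by lra.
  by move=> /(expR_ge1Dxn k); lra.
have f0 : 0 < (k.+1)`!%:R :> R by rewrite ltr0n fact_gt0.
rewrite ler_pdivlMr // expr_div_n ler_pdivlMr ?exprn_gt0 //.
apply: (@le_trans _ _ (a * ln u ^+ k)).
  set F := (_`!)%:R in f0 *; set P := 2 ^+ _; set lk := ln u ^+ k.
  have P0 : 0 <= P by rewrite exprn_ge0.
  have lk0 : 0 <= lk by rewrite exprn_ge0.
  have -> : K * lk * F * P = K * (F * P * lk) by ring.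
  have -> : a * lk = `|K| * (F * P * lk) by rewrite /a -/F -/P; ring.
  by rewrite ler_wpM2r ?ler_norm ?mulr_ge0 // ltW.
by rewrite exprS ler_pM ?exprn_ge0 // lerXn2r ?nnegrE //; lra.
Qed.

(** The sieve's main term dominates its O(sqrt n) error. The free constant M later absorbs the
    bounded loss from incomplete windows. *)
Lemma sifted_count_ge (R : realType) (b k : nat) (M : R) : (0 < b)%N ->
  exists2 c : R, 0 < c & exists n0 : nat,
  forall (n m : nat) (bad : nat -> pred nat), (n0 <= n)%N -> (0 < m <= n)%N ->
  (forall p x, bad p (x + p)%N = bad p x) ->
  {in primes m, forall p, let w := count (bad p) (iota 0 p) in (w <= k)%N && (w < p)%N} ->
  c * (n%:R / ln (ln n%:R) ^+ k) + M <=
    (\sum_(j < n %/ b) all (fun p => ~~ bad p j) (primes m))%:R.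
Proof.
move=> b0; have bR : 0 < b%:R :> R by rewrite ltr0n.
have [c0 c0_gt0 density] := sieve_density_ge R k.
have [K K0 remainder] := sieve_remainder_le R k.
(* One factor 2 is lost in n %/ b >= n/(2b); the other leaves half of the main term to cover (K +
   |M|) sqrt n. *)
pose c := c0 / (4 * b%:R).
have c_gt0 : 0 < c by rewrite divr_gt0 // mulr_gt0.
exists c => //.
have [n1 Hn1] := exp_half_ln_dominates k ((K + `|M|) / c).
exists (maxn (maxn 16 (2 * b)) n1) => n m bad.
rewrite !geq_max => /andP[/andP[n16 n2b] nn1] mn per wb.
have u2 := ln_ge2 R n16.
have l0 : 0 < ln (ln n%:R) :> R by rewrite ln_gt0; lra.
have lk0 := exprn_gt0 k l0.
have nE : n%:R = expR (ln n%:R / 2) * expR (ln n%:R / 2) :> R.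
  by rewrite -expRD -splitr lnK // posrE ltr0n; lia.
have {Hn1} := Hn1 n nn1.
move: nE; set s := expR _ => nE; set lk := ln (ln n%:R) ^+ k => dom.
have s0 : 1 <= s by apply: le_trans (expR_ge1Dx _); lra.
have := @sieve_error R (primes m) bad (n %/ b) (n %/ b)%:R (primes_uniq m).
have pr : all prime (primes m) by apply/allP => p; rewrite mem_primes => /andP[].
move=> /(_ pr (fun p x _ => per p x)).
rewrite subrr normr0 ler01 => /(_ isT) /=.
set count := (\sum_(_ < _) _)%N; set D := \prod_(_ <- _) (_ - _).
set Er := \prod_(_ <- _) _ => err.
have Dge : c0 / lk <= D := density n m _ n16 mn wb.
have ErK : Er <= K * s.
  by apply: remainder mn _ => p /wb /andP[].
have Nge : n%:R / (2 * b%:R) <= (n %/ b)%:R :> R.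
  rewrite ler_pdivrMr ?mulr_gt0 // -!natrM ler_nat.
  rewrite mulnCA mul2n -addnn; have := divn_eq n b; have := ltn_pmod n b0.
  by move: n2b; clear; lia.
have main : 2 * (c * (n%:R / lk)) <= (n %/ b)%:R * D.
  have -> : 2 * (c * (n%:R / lk)) = (n%:R / (2 * b%:R)) * (c0 / lk).
    by rewrite /c; field; rewrite !lt0r_neq0.
  by apply: ler_pM => //; rewrite divr_ge0 // ?mulr_ge0 // ltW.
have : (K + `|M|) * s <= c * (n%:R / lk).
  rewrite mulrA ler_pdivlMr // nE mulrAC mulrA ler_pM2r; last by lra.
  by move: dom; rewrite mulrAC ler_pdivrMr // [s * c]mulrC.
have : M <= `|M| * s.
  by apply: le_trans (ler_norm M) _; rewrite ler_peMr.
move: err; rewrite ler_distl => /andP[err _].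
rewrite mulrDl; lra.
Qed.

(** Since b is invertible modulo p, the count equals that of the multiples of p in [0, p). *)
Lemma count_dvd_linear_le (p b i : nat) : prime p -> ~~ (p %| b)%N ->
  (count (fun j => p %| b * j + i)%N (iota 0 p) <= 1)%N.
Proof.
move=> pp pb; rewrite (eq_count (a2 := fun j => p %| i + b * j)%N) => [|j]; last by rewrite addnC.
rewrite (@count_arith_progression p b i (dvdn p)); last first.
- by move=> x; rewrite dvdn_addl.
- by rewrite coprime_sym prime_coprime.
case: p pp {pb} => // p _.
rewrite (@eq_in_count _ _ (pred1 0%N)) => [|j].
  by rewrite count_uniq_mem ?iota_uniq // leq_b1.
rewrite mem_iota /= add0n; case: j => [|j] jp; first by rewrite dvdn0.
by apply/negbTE; rewrite gtnNdvd.
Qed.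

Lemma count_has_dvd_linear_le (p b : nat) (s : seq nat) : prime p -> ~~ (p %| b)%N ->
  (count (fun j => has (fun i => p %| b * j + i)%N s) (iota 0 p) <= size s)%N.
Proof.
move=> pp pb; elim: s => [|i s IHs] /=; first by rewrite count_pred0.
rewrite -addn1 addnC; apply: leq_trans (leq_add (count_dvd_linear_le i pp pb) IHs).
by rewrite -count_predUI leq_addr.
Qed.

(** Call j bad modulo p when p divides some b j + i with i in s: this removes at most [size s] < p
    classes. A surviving j works, since a common divisor of m and b j + i above 1 would have a prime
    factor in [primes m]. *)
Lemma coprime_linear_count_ge (R : realType) (b k : nat) (s : seq nat) (M : R) :
  (0 < b)%N -> (size s <= k)%N ->
  exists2 c : R, 0 < c & exists n0 : nat,
  forall n m : nat, (n0 <= n)%N -> (0 < m <= n)%N ->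
  {in primes m, forall p, ~~ (p %| b)%N && (size s < p)%N} ->
  c * (n%:R / ln (ln n%:R) ^+ k) + M <=
    (\sum_(j < n %/ b) all (fun i => coprime m (b * j + i)) s)%:R.
Proof.
move=> b0 sk; have [c c0 [n0 Hn0]] := sifted_count_ge k M b0.
exists c => //; exists n0 => n m nn0 mn mp.
have m0 : (0 < m)%N by case/andP: mn.
apply: le_trans (Hn0 n m (fun p j => has (fun i => p %| b * j + i)%N s) nn0 mn _ _) _.
- by move=> p x; apply: eq_has => i; rewrite mulnDr addnAC dvdn_addl ?dvdn_mull.
- move=> p pm /=; have /andP[pb sp] := mp p pm.
  have pp : prime p by move: pm; rewrite mem_primes => /andP[].
  have := count_has_dvd_linear_le s pp pb; lia.
rewrite ler_nat; apply: leq_sum => j _.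
case: (boolP (all (fun p => _) (primes m))) => // /allP sieved.
rewrite lt0b; apply/allP => i si; apply: contraT => ncop.
have g1 : (1 < gcdn m (b * j + i))%N.
  by rewrite ltn_neqAle eq_sym ncop gcdn_gt0 m0.
have [pm px] : (pdiv (gcdn m (b * j + i)) %| m)%N /\ (pdiv (gcdn m (b * j + i)) %| b * j + i)%N.
  by split; apply: dvdn_trans (pdiv_dvd _) _; rewrite ?dvdn_gcdl ?dvdn_gcdr.
have /sieved/hasPn/(_ i si) : pdiv (gcdn m (b * j + i)) \in primes m.
  by rewrite mem_primes pdiv_prime // m0.
by rewrite px.
Qed.

(** * From the sifted count to the gap *)

Lemma gap_ge (R : numDomainType) (k n : nat) (x : R) : (0 < k)%N -> (0 < n)%N ->
  (forall A : {set 'I_n.+1}, A \in C k n -> ~~ (A \subset E k n) ->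
     x <= #|E k n|%:R - #|A|%:R) ->
  x <= #|E k n|%:R - (maxC_notin_E k n)%:R.
Proof.
move=> k0 n0 H; rewrite /maxC_notin_E.
(* The family is nonempty, so the maximum is attained by a member and is not the default 0. *)
have [A0 A0P] := C_notin_E k0 n0.
have [|A /andP[AC AE] ->] := @eq_bigmax_cond _
  [pred A : {set 'I_n.+1} | (A \in C k n) && ~~ (A \subset E k n)] (fun A => #|A|).
  by apply/card_gt0P; exists A0.
exact: H.
Qed.

(** Common form of both cases: windows of length b, v elements of [E k n] counted per window, and
    sieved offsets s. Each j surviving the sieve costs A one element of its window. *)
Lemma gap_from_blocks (R : realType) (k b v : nat) (s : seq nat) (e : nat) :
  (0 < k)%N -> (0 < b)%N -> (size s <= e)%N ->
  (forall n, (v * (n %/ b) <= #|E k n|)%N) ->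
  (forall (n m j : nat) (A : {set 'I_n.+1}), A \in C k n -> nat_mem A m ->
    (\sum_(i < b) nat_mem A (b * j + i.+1) + all (fun i => coprime m (b * j + i)) s
       <= v + (j == 0))%N) ->
  (forall p m, prime p -> (p %| m)%N -> {in iota 1 k, forall i, ~~ (nth_prime i %| m)%N} ->
     ~~ (p %| b)%N && (size s < p)%N) ->
  exists2 c : R, 0 < c & exists n0 : nat, forall n : nat, (n0 <= n)%N ->
    c * (n%:R / ln (ln n%:R) ^+ e) <= #|E k n|%:R - (maxC_notin_E k n)%:R.
Proof.
move=> k0 b0 se E_ge block large.
(* The choice M = b+1 cancels the additive loss of [card_add_sifted_le]. *)
have [c c0 [n0 Hn0]] := @coprime_linear_count_ge R b e s b.+1%:R b0 se.
exists c => //; exists (maxn 1 n0) => n; rewrite geq_max => /andP[n1 nn0].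
apply: (@gap_ge R k n _ k0 n1) => A AC AE.
have [m [mA mn mE]] := notin_E AC AE.
have := @card_add_sifted_le n b v A (fun j => all (fun i => coprime m (b * j + i)%N) s) b0
  (fun j => block n m j A AC mA).
set count := (\sum_(_ < _) _)%N => bound.
have : c * (n%:R / ln (ln n%:R) ^+ e) + b.+1%:R <= count%:R.
  apply: Hn0 => // p; rewrite mem_primes => /and3P[pp _ pm].
  exact: large pm mE.
have : (#|A|%:R + count%:R <= #|E k n|%:R + b.+1%:R :> R).
  by rewrite -!natrD ler_nat; apply: leq_trans bound _; rewrite leq_add2r.
lra.
Qed.

Lemma large_prime_factor (p m k : nat) : prime p -> (p %| m)%N ->
  {in iota 1 k, forall i, ~~ (nth_prime i %| m)%N} ->
  {in iota 1 k, forall i, p != nth_prime i}.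
Proof. by move=> pp pm mE i /mE; apply: contra => /eqP <-. Qed.

Theorem theorem3 (R : realType) :
  exists (c : R) (n0 : nat), 0 < c /\
    forall n : nat, (n0 <= n)%N ->
      (#|E 1 n|%:R - (maxC_notin_E 1 n)%:R >=
         c * (n%:R / (ln (ln (n%:R : R))) ^+ 2)) /\
      (#|E 2 n|%:R - (maxC_notin_E 2 n)%:R >=
         c * (n%:R / (ln (ln (n%:R : R))) ^+ 5)).
Proof.
have [|c1 c1_gt0 [n1 gap1]] := @gap_from_blocks R 1 2 1 [:: 1; 2]%N 2
  isT isT isT card_E1_ge pair_block_le.
  move=> p m pp pm /(large_prime_factor pp pm)/(_ 1%N isT); rewrite nth_prime1 => p2.
  have := prime_gt1 pp; rewrite dvdn_prime2 //= p2; lia.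
have [|c2 c2_gt0 [n2 gap2]] := @gap_from_blocks R 2 6 4 [:: 1; 3; 4; 5]%N 5
  isT isT isT card_E2_ge triple_block_le.
  move=> p m pp pm /(large_prime_factor pp pm) pE.
  have p2 := pE 1%N isT; have p3 := pE 2%N isT; rewrite nth_prime1 in p2; rewrite nth_prime2 in p3.
  (* The four sieved offsets require p > 4: m is coprime to 2 and 3, and 4 is not prime. *)
  have p4 : p != 4 by apply: contraTneq pp => ->.
  have p1 := prime_gt1 pp.
  rewrite -[6%N]/(2 * 3)%N Euclid_dvdM // !dvdn_prime2 // (negbTE p2) (negbTE p3) /=; lia.
exists (Num.min c1 c2), (maxn 16 (maxn n1 n2)); split; first by rewrite lt_min c1_gt0.
move=> n; rewrite !geq_max => /and3P[n16 nn1 nn2].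
have l0 : 0 < ln (ln n%:R) :> R by rewrite ln_gt0; have := ln_ge2 R n16; lra.
by split; [apply: le_trans (gap1 n nn1)|apply: le_trans (gap2 n nn2)];
  rewrite ler_wpM2r ?ge_min ?lexx ?orbT // divr_ge0 // exprn_ge0 // ltW.
Qed.
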